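(* For every positive integer $n$, $R_n^{B,+}(t)=R_n^{D}(t)$ and $R_n^{B,-}(t)=R_n^{B-D}(t)$.
   Context: $\mathfrak{B}_n$ is the group of signed permutations in window notation $\pi=\pi_1\cdots\pi_n$, with $\mathrm{inv}_B(\pi)=|\{i<j:\pi_i>\pi_j\}|+|\{i<j:-\pi_i>\pi_j\}|+|\{i:\pi_i<0\}|$; $\mathfrak{B}_n^+$ is the set of $\pi$ with $\mathrm{inv}_B(\pi)$ even and $\mathfrak{B}_n^-=\mathfrak{B}_n\setminus\mathfrak{B}_n^+$; $\mathfrak{D}_n$ is the set of $\pi\in\mathfrak{B}_n$ with an even number of negative entries. Set $\pi_0=0$; $\mathrm{pk}_B(\pi)$ (resp. $\mathrm{val}_B(\pi)$) is the number of $i\in\{1,\dots,n-1\}$ with $\pi_{i-1}<\pi_i>\pi_{i+1}$ (resp. $\pi_{i-1}>\pi_i<\pi_{i+1}$), and $\mathrm{altruns}_B(\pi)=\mathrm{pk}_B(\pi)+\mathrm{val}_B(\pi)+1$. For a subset $X\subseteq\mathfrak{B}_n$ write $\sum_{\pi\in X}t^{\mathrm{altruns}_B(\pi)}$; then $R_n^{B,\pm}$ is this sum over $\mathfrak{B}_n^{\pm}$, $R_n^D$ over $\mathfrak{D}_n$, and $R_n^{B-D}$ over $\mathfrak{B}_n\setminus\mathfrak{D}_n$. *)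

(* Defs.v *)
From mathcomp Require Import all_boot all_order all_fingroup all_algebra.

Set Implicit Arguments.
Unset Strict Implicit.
Unset Printing Implicit Defensive.

Import Order.TTheory GRing.Theory Num.Theory.
Local Open Scope ring_scope.

(* The set {-n, ..., -1, 1, ..., n}: (k, false) stands for k + 1 and
   (k, true) for -(k + 1). *)
Definition letter (n : nat) : finType := ('I_n * bool)%type.

Definition letter_val (n : nat) (x : letter n) : int :=
  (-1) ^+ x.2 * (x.1.+1)%:Z.

Definition letter_opp (n : nat) (x : letter n) : letter n := (x.1, ~~ x.2).

(* The permutations pi of {-n, ..., -1, 1, ..., n} with pi(-x) = -pi(x). *)
Definition signed_perms (n : nat) : {set {perm letter n}} :=
  [set pi : {perm letter n} |
    [forall x : letter n, pi (letter_opp x) == letter_opp (pi x)]].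

Lemma signed_perms_group_set (n : nat) : group_set (signed_perms n).
Proof.
apply/group_setP; split=> [|p q]; first by rewrite inE; apply/forallP=> x; rewrite !perm1.
rewrite !inE => /forallP hp /forallP hq; apply/forallP=> x.
by rewrite !permM (eqP (hp x)) (eqP (hq _)).
Qed.

Canonical signed_perms_group (n : nat) := Group (signed_perms_group_set n).

(* Ordinals start at 0: [window pi i] is pi_(i+1). *)
Definition window (n : nat) (pi : {perm letter n}) (i : 'I_n) : int :=
  letter_val (pi (i, false)).

(* [entry pi k] is pi_k for 1 <= k <= n, and pi_0 = 0; the value 0 for
   k > n is junk. *)
Definition entry (n : nat) (pi : {perm letter n}) (k : nat) : int :=
  if k is j.+1 then oapp (window pi) 0 (insub j : option 'I_n) else 0.

Definition neg_count (n : nat) (pi : {perm letter n}) : nat :=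
  #|[set i : 'I_n | window pi i < 0]|.

Definition invB (n : nat) (pi : {perm letter n}) : nat :=
  (#|[set p : 'I_n * 'I_n | (p.1 < p.2)%N && (window pi p.1 > window pi p.2)%R]|
   + #|[set p : 'I_n * 'I_n | (p.1 < p.2)%N && (- window pi p.1 > window pi p.2)%R]|
   + neg_count pi)%N.

Definition pkB (n : nat) (pi : {perm letter n}) : nat :=
  count (fun i : nat => (entry pi i.-1 < entry pi i) && (entry pi i > entry pi i.+1))
    (index_iota 1 n).

Definition valB (n : nat) (pi : {perm letter n}) : nat :=
  count (fun i : nat => (entry pi i.-1 > entry pi i) && (entry pi i < entry pi i.+1))
    (index_iota 1 n).

Definition altrunsB (n : nat) (pi : {perm letter n}) : nat :=
  (pkB pi + valB pi + 1)%N.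

Definition B_plus (n : nat) : {set {perm letter n}} :=
  [set pi in signed_perms n | ~~ odd (invB pi)].

Definition B_minus (n : nat) : {set {perm letter n}} :=
  signed_perms n :\: B_plus n.

Definition D_perms (n : nat) : {set {perm letter n}} :=
  [set pi in signed_perms n | ~~ odd (neg_count pi)].

Definition altruns_poly (n : nat) (X : {set {perm letter n}}) : {poly int} :=
  \sum_(pi in X) 'X^(altrunsB pi).

Definition R_B_plus (n : nat) : {poly int} := altruns_poly (B_plus n).
Definition R_B_minus (n : nat) : {poly int} := altruns_poly (B_minus n).
Definition R_D (n : nat) : {poly int} := altruns_poly (D_perms n).
Definition R_B_D (n : nat) : {poly int} :=
  altruns_poly (signed_perms n :\: D_perms n).

(* Main.v *)
Require Import Defs.
From mathcomp Require Import all_boot all_order all_fingroup all_algebra.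
From mathcomp Require Import zify.

(** Let [f pi = [inv_B pi even] - [neg pi even]].  Given a position [k0], flip the
    sign of the entry of smallest absolute value among [pi_(k0+1), ..., pi_n].
    This is an involution which reverses both parities (since [inv_B] has the
    parity of [neg] plus the number of inversions of [|pi|]), and it does not
    affect any descent except possibly the one at [k0].  Hence the sum of [f] over
    the descent class of [D], for [k0] not in [D], is opposite to the sum over the
    class of [D] with [k0] added; all these sums are thus, up to sign, the sum over
    the class of the empty set, where [f] vanishes.  Finally [altruns_B pi] only
    depends on the descent set of [pi]. *)

Set Implicit Arguments.
Unset Strict Implicit.
Unset Printing Implicit Defensive.

Import Order.TTheory GRing.Theory Num.Theory.
Local Open Scope ring_scope.

(** The sign of the letter of larger absolute value decides the comparison, so changing the sign of
    the other letter is harmless. *)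
Lemma lt_letter_val n (x y : letter n) :
  (letter_val x < letter_val y) =
  if (x.1 < y.1)%N then ~~ y.2 else if (y.1 < x.1)%N then x.2 else x.2 && ~~ y.2.
Proof.
case: x y => [i []] [j []]; rewrite /letter_val /= ?expr1 ?expr0 ?mulN1r ?mul1r; try lia.
all: case: ltngtP; lia.
Qed.

Lemma letter_val_abs_inj n (x y : letter n) : letter_val x = letter_val y -> x.1 = y.1.
Proof.
move=> /(congr1 absz); rewrite /letter_val !abszMsign => -[eqxy].
exact: val_inj.
Qed.

Lemma letter_valN n (x : letter n) : - letter_val x = letter_val (letter_opp x).
Proof.
by case: x => i []; rewrite /letter_val /= ?expr1 ?expr0 ?mulN1r ?mul1r ?opprK.
Qed.

Lemma letter_val_lt0 n (x : letter n) : (letter_val x < 0) = x.2.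
Proof. by case: x => i []; rewrite /letter_val /= ?expr1 ?expr0 ?mulN1r ?mul1r; lia. Qed.

Lemma odd_card (T : finType) (P : pred T) :
  odd #|[set x | P x]| = \big[addb/false]_x P x.
Proof.
rewrite -sum1_card (big_morph odd oddD (erefl _)) big_mkcond /=.
by apply: eq_bigr => x _; rewrite inE; case: (P x).
Qed.

(** * Parity of [invB] and descent sets *)

Section Windows.
Variable n : nat.
Implicit Types (pi : {perm letter n}) (i j k : 'I_n) (D : {set 'I_n}).

Definition abs_window pi i : 'I_n := (pi (i, false)).1.

Lemma abs_window_inj pi : pi \in signed_perms n -> injective (abs_window pi).
Proof.
rewrite inE => /forallP piS i j; rewrite /abs_window => eq_ij.
have [eq2|neq2] := eqVneq (pi (i, false)).2 (pi (j, false)).2.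
  have /perm_inj [] // : pi (i, false) = pi (j, false).
  by rewrite [LHS]surjective_pairing eq_ij eq2 -surjective_pairing.
have /perm_inj [] // : pi (i, false) = pi (j, true).
rewrite (eqP (piS (j, false))) /letter_opp -eq_ij.
rewrite [LHS]surjective_pairing; congr pair.
by case: (pi (i, false)).2 neq2; case: (pi (j, false)).2.
Qed.

Lemma entryS pi i : entry pi i.+1 = window pi i.
Proof. by rewrite /entry valK. Qed.

(** For [i < j], if [|pi_j|] is the larger, the conditions [pi_i > pi_j] and [-pi_i > pi_j] are
    equivalent and cancel modulo 2; if [|pi_i|] is the larger, exactly one of them holds. *)
Lemma odd_invB pi : pi \in signed_perms n ->
  odd (invB pi) = odd (neg_count pi) (+)
    odd #|[set p : 'I_n * 'I_n |
            (p.1 < p.2)%N && (abs_window pi p.2 < abs_window pi p.1)%N]|.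
Proof.
move=> piS; rewrite /invB oddD addbC; congr addb.
rewrite oddD !odd_card -big_split /=; apply: eq_bigr => -[i j] _ /=.
case: ltnP => //= ltij.
have := inj_eq (abs_window_inj piS) j i.
rewrite -[RHS]val_eqE /= (gtn_eqF ltij) -val_eqE /window letter_valN !lt_letter_val.
by rewrite /abs_window /=; case: ltngtP => //= _ _; rewrite ?addNb ?addbN addbb.
Qed.

(** The type B descent set: position 0 belongs to it when the first entry is negative. *)
Definition descents pi : {set 'I_n} := [set k : 'I_n | entry pi k.+1 < entry pi k].

Lemma entry_lt pi k : pi \in signed_perms n ->
  (entry pi k < entry pi k.+1) = (k \notin descents pi).
Proof.
move=> piS; rewrite inE -leNgt lt_def andb_idl // => _; rewrite entryS.
case: k => -[|k] ltkn.
  by rewrite /= /window /letter_val mulf_neq0 // signr_eq0.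
rewrite -[k]/(val (Ordinal (ltnW ltkn))) entryS.
apply/eqP=> /letter_val_abs_inj /(abs_window_inj piS) /(congr1 val) /=; lia.
Qed.

(** A peak at [m] is an ascent at [m.-1] followed by a descent at [m]; a valley is the reverse.
    Mapping [D] to a list of naturals allows testing [m.-1] without a bound proof. *)
Definition altruns_of_descents D : nat :=
  (count (fun m => (m.-1 \notin map val (enum D)) && (m \in map val (enum D)))
     (index_iota 1 n) +
   count (fun m => (m.-1 \in map val (enum D)) && (m \notin map val (enum D)))
     (index_iota 1 n) + 1)%N.

Lemma altrunsB_descents pi : pi \in signed_perms n ->
  altrunsB pi = altruns_of_descents (descents pi).
Proof.
move=> piS; rewrite /altrunsB /pkB /valB /altruns_of_descents.
have mem k : (val k \in map val (enum (descents pi))) = (k \in descents pi).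
  by rewrite mem_map ?mem_enum //; apply: val_inj.
congr (_ + _ + 1)%N; apply: eq_in_count => -[|i];
  rewrite mem_index_iota //= => ltin;
  have := (mem (Ordinal (ltnW ltin)), mem (Ordinal ltin),
    entry_lt (Ordinal (ltnW ltin)) piS, entry_lt (Ordinal ltin) piS) => /= E;
  by rewrite !E !inE.
Qed.

(** * The sign-flipping involution *)

Section Flip.
Variable k0 : 'I_n.

Definition flip_index pi : 'I_n :=
  [arg min_(i < k0 | (k0 <= i)%N) (abs_window pi i : nat)]%N.

(** The left factor acts first, so the transposition exchanges two opposite values, not two
    positions. *)
Definition flip pi : {perm letter n} :=
  let v := abs_window pi (flip_index pi) in (pi * tperm (v, false) (v, true))%g.

Lemma flipE pi i : flip pi (i, false) =
  (abs_window pi i,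
   (pi (i, false)).2 (+) (abs_window pi i == abs_window pi (flip_index pi))).
Proof.
rewrite /flip permM /abs_window; case: (pi (i, false)) => a s /=.
have [->|nea] := eqVneq a; first by case: s; rewrite ?tpermL ?tpermR.
by rewrite addbF tpermD // -pair_eqE /= eq_sym (negPf nea).
Qed.

Lemma abs_window_flip pi : abs_window (flip pi) =1 abs_window pi.
Proof. by move=> i; rewrite /abs_window flipE. Qed.

(** The index depends only on absolute values, which [flip] preserves; hence [flip] undoes
    itself. *)
Lemma flip_index_flip pi : flip_index (flip pi) = flip_index pi.
Proof.
rewrite /flip_index /arg_min /extremum; congr odflt; apply: eq_pick => i /=.
congr andb; apply: eq_forallb => j /=.
by rewrite !abs_window_flip.
Qed.

Lemma flipK : involutive flip.
Proof.
move=> pi; rewrite {1}/flip flip_index_flip abs_window_flip /flip.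
by rewrite -mulgA tperm2 mulg1.
Qed.

Lemma flip_signed pi : (flip pi \in signed_perms n) = (pi \in signed_perms n).
Proof.
rewrite /flip groupMr // inE; apply/forallP => -[a s]; apply/eqP.
set v := abs_window _ _; rewrite /letter_opp /=.
have [->|nea] := eqVneq a v; first by case: s; rewrite ?tpermL ?tpermR.
by rewrite !tpermD // -pair_eqE /= eq_sym (negPf nea).
Qed.

Section SignedFlip.
Variable pi : {perm letter n}.
Hypothesis piS : pi \in signed_perms n.

Lemma sign_flip i : (flip pi (i, false)).2 = (pi (i, false)).2 (+) (i == flip_index pi).
Proof. by rewrite flipE /= inj_eq //; apply: abs_window_inj. Qed.

Lemma odd_neg_count_flip : odd (neg_count (flip pi)) = ~~ odd (neg_count pi).
Proof.
rewrite /neg_count !odd_card (bigD1 (flip_index pi)) //= [in RHS](bigD1 (flip_index pi)) //=.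
rewrite /window !letter_val_lt0 sign_flip eqxx addbT addNb; congr (~~ (_ (+) _)).
by apply: eq_bigr => i /negPf ni; rewrite !letter_val_lt0 sign_flip ni addbF.
Qed.

Lemma odd_invB_flip : odd (invB (flip pi)) = ~~ odd (invB pi).
Proof.
rewrite !odd_invB ?flip_signed // odd_neg_count_flip addNb.
congr (~~ (_ (+) odd #|pred_of_set _|)).
by apply/setP=> p; rewrite !inE !abs_window_flip.
Qed.

Lemma descents_flip k : k != k0 -> (k \in descents (flip pi)) = (k \in descents pi).
Proof.
have [lek0 min_m] : (k0 <= flip_index pi)%N /\
    forall j, (k0 <= j)%N -> (abs_window pi (flip_index pi) <= abs_window pi j)%N.
  by rewrite /flip_index; case: arg_minnP.
have same i : i != flip_index pi -> window (flip pi) i = window pi i.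
  move=> /negPf ni; rewrite /window; congr letter_val.
  by rewrite [LHS]surjective_pairing sign_flip ni addbF flipE /= /abs_window -surjective_pairing.
move=> nek; rewrite !inE !entryS.
(* At position 0 only the first entry matters; as [k0] is then positive, that entry is not
   flipped. *)
case: k nek => -[|k] ltkn nek.
  rewrite same //=; apply: contraNneq nek => eqm.
  by rewrite -val_eqE /= eq_sym -leqn0 (leq_trans lek0) // -eqm.
set k1 := Ordinal ltkn; set j := Ordinal (ltnW ltkn).
rewrite -[nat_of_ord k1]/(val j).+1 !entryS.
(* Before [k0], neither compared entry is flipped. After it, both lie in the range of the minimum,
   so a flipped one has the smaller absolute value and does not decide the comparison. *)
have [ltk|gek] := ltnP k1 k0.
  by rewrite !same // -val_eqE /= ltn_eqF // (leq_trans _ lek0) // ltnW.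
have lej : (k0 <= j)%N by move: nek gek; rewrite -val_eqE /=; lia.
have nejk : k1 != j by rewrite -val_eqE /= gtn_eqF.
have := inj_eq (abs_window_inj piS) k1 j; rewrite (negPf nejk) => /negbT.
rewrite -val_eqE /= => nea.
rewrite /window !lt_letter_val !sign_flip -!/(abs_window _ _) !abs_window_flip.
have [ek|nk] := eqVneq k1 (flip_index pi).
  have := min_m j lej; rewrite -ek leq_eqVlt (negPf nea) /= => ->.
  by rewrite eq_sym (negPf nejk) addbF.
have [ej|nj] := eqVneq j (flip_index pi); last by rewrite !addbF.
have := min_m k1 gek; rewrite -ej leq_eqVlt eq_sym (negPf nea) /= => ltjk.
by rewrite ltjk ltnNge (ltnW ltjk) /= addbF.
Qed.

End SignedFlip.
End Flip.

(** * Cancellation over descent classes *)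

Definition parity_diff pi : int :=
  (~~ odd (invB pi))%:R - (~~ odd (neg_count pi))%:R.

Definition class_sum D : int :=
  \sum_(pi in signed_perms n | descents pi == D) parity_diff pi.

Lemma class_sum_add k0 D : k0 \notin D -> class_sum (k0 |: D) = - class_sum D.
Proof.
move=> k0D; apply/eqP; rewrite -addr_eq0 addrC; apply/eqP.
have -> : class_sum D + class_sum (k0 |: D) =
    \sum_(pi in signed_perms n | descents pi :\ k0 == D) parity_diff pi.
  rewrite [RHS](bigID (fun pi => k0 \in descents pi)) /= addrC /class_sum.
  congr (_ + _); apply: eq_bigl => pi; rewrite -andbA; congr andb.
    apply/eqP/andP => [->|[/eqP eqD k0pi]].
      by rewrite k0D; split=> //; apply/eqP/setDidPl; rewrite disjoint_sym disjoints1.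
    by rewrite -eqD; apply/esym/setDidPl; rewrite disjoint_sym disjoints1.
  apply/eqP/andP => [->|[/eqP <- k0pi]]; last by rewrite setD1K.
  by rewrite setU1K // setU11.
(* The union of the two classes is stable under [flip k0], which negates every summand. *)
set S := LHS; suff : S = - S by lia.
rewrite {1}/S (reindex_inj (inv_inj (flipK k0))) /= -sumrN.
apply: congr_big => // pi.
  rewrite flip_signed; case piS: (pi \in _) => //=; congr (_ == D).
  by apply/setP=> k; rewrite !in_setD1; case: eqVneq => //= nek; rewrite descents_flip.
rewrite flip_signed => /andP[piS _].
rewrite /parity_diff odd_invB_flip // odd_neg_count_flip //.
by case: odd; case: odd.
Qed.

(** Without descents the entries increase from [pi_0 = 0], so they are positive and both statistics
    vanish. *)
Lemma class_sum_set0 : class_sum set0 = 0.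
Proof.
apply: big1 => pi /andP[piS /eqP des0]; rewrite /parity_diff.
have inc k : entry pi k < entry pi k.+1 by rewrite entry_lt // des0 inE.
have mono (i j : nat) : (i < j <= n)%N -> entry pi i < entry pi j.
  elim: j => // j IHj /andP[]; rewrite ltnS leq_eqVlt => /predU1P[->|ltij] ltjn.
    exact: (inc (Ordinal ltjn)).
  by apply: lt_trans (inc (Ordinal ltjn)); rewrite IHj // ltij ltnW.
have pos i : 0 < window pi i by rewrite -entryS (mono 0) //= ltn_ord.
have neg0 : neg_count pi = 0%N.
  by apply: eq_card0 => i; rewrite inE ltNge ltW.
suff -> : invB pi = 0%N by rewrite neg0 subrr.
rewrite /invB neg0 addn0; apply/eqP; rewrite addn_eq0 !cards_eq0.
apply/andP; split; apply/eqP/setP=> -[i j]; rewrite !inE /=.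
  by case: ltnP => //= ltij; rewrite ltNge -!entryS ltW // mono // ltnS ltij ltn_ord.
by have := pos i; have := pos j; case: ltnP => //= _; lia.
Qed.

Lemma class_sum_eq0 D : class_sum D = 0.
Proof.
move: {2}#|D| (leqnn #|D|) => m; elim: m D => [|m IHm] D.
  by rewrite leqn0 cards_eq0 => /eqP ->; apply: class_sum_set0.
have [->|[k kD]] := set_0Vmem D; first by rewrite class_sum_set0.
rewrite (cardsD1 k) kD ltnS => leDm.
by rewrite -(setD1K kD) class_sum_add ?setD11 // IHm ?oppr0.
Qed.

Lemma R_B_plus_eq_R_D : R_B_plus n = R_D n.
Proof.
apply/eqP; rewrite -subr_eq0; apply/eqP.
transitivity (\sum_(pi in signed_perms n)
    parity_diff pi *: 'X^(altruns_of_descents (descents pi)) : {poly int}).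
  rewrite /R_B_plus /R_D /altruns_poly.
  under eq_bigl do rewrite inE; under [X in _ - X]eq_bigl do rewrite inE.
  rewrite !big_mkcondr -sumrB; apply: eq_bigr => pi piS.
  rewrite -altrunsB_descents // /parity_diff scalerBl.
  by case: odd; case: odd; rewrite /= ?scale1r ?scale0r.
rewrite (partition_big descents predT) //= big1 // => D _.
transitivity (class_sum D *: 'X^(altruns_of_descents D) : {poly int}).
  by rewrite scaler_suml; apply: eq_bigr => pi /andP[_ /eqP ->].
by rewrite class_sum_eq0 scale0r.
Qed.

Lemma altruns_polyD (A B : {set {perm letter n}}) : B \subset A ->
  altruns_poly (A :\: B) = altruns_poly A - altruns_poly B.
Proof.
move=> /setIidPr eqB; rewrite /altruns_poly [in RHS](big_setID B) /= eqB.
by rewrite addrAC subrr add0r.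
Qed.

End Windows.

Theorem theorem53 (n : nat) (n_gt0 : (0 < n)%N) :
  R_B_plus n = R_D n /\ R_B_minus n = R_B_D n.
Proof.
have eqp := R_B_plus_eq_R_D n; split=> //.
(* Both sides are complements in the same group, so the first identity gives the second. *)
rewrite /R_B_minus /R_B_D !altruns_polyD -?/(R_B_plus n) -?/(R_D n) ?eqp //.
  by apply/subsetP=> pi; rewrite inE => /andP[].
by apply/subsetP=> pi; rewrite inE => /andP[].
Qed.
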